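(* Let $I$ be a proper monomial ideal in a polynomial ring $R$ in finitely many variables over a field. Let $b_0,\dots,b_t$ be distinct variables of $R$ and let $1\le q\le t$. Suppose $d_{b_i}(I)\le 1$ for $1\le i\le t$; that for each $1\le i\le q-1$ every minimal monomial generator of $I$ divisible by $b_{i-1}$ is divisible by $b_i$; and that every minimal monomial generator of $I$ divisible by $b_{q-1}$ is divisible by at least one of $b_q,\dots,b_t$. Put $f_i=b_{i-1}+b_i$ for $1\le i\le q-1$ and $f_q=b_{q-1}+b_q+\cdots+b_t$. Let $\{y_1,\dots,y_r\}$ be a set of variables of $R$ with $\{y_1,\dots,y_r\}\cap\{b_0,\dots,b_t\}=\emptyset$, and let $\{c_{i,j}\mid 1\le i\le \ell,\ 0\le j\le s_i\}\subseteq\{y_1,\dots,y_r\}$ be distinct variables such that $d_{c_{i,j}}(I)\le 1$ for all $1\le i\le \ell$ and $1\le j\le s_i$, and such that for each $i$, every minimal monomial generator of $I$ divisible by $c_{i,0}$ is divisible by $c_{i,j}$ for some $j\ge1$. Put $g_i=\sum_{j=0}^{s_i}c_{i,j}$ for $1\le i\le \ell$. Fix a term order $>$ on $R$ with $b_0>b_1>\cdots>b_t$ and $c_{i,0}>c_{i,j}$ for all $1\le i\le\ell$ and $1\le j\le s_i$. Then any sequence obtained by merging a subsequence of $f_1, \ldots, f_q$ and a subsequence of $g_1, \ldots, g_{\ell}$ in any order, subject to the requirement that whenever $f_i$ and $f_j$ both appear with $i<j$ then $f_i$ precedes $f_j$, is an initially regular sequence on $R/I$ with respect to $>$.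
   Context: $\mathfrak m$ is the ideal of $R$ generated by all the variables. A term order is a monomial order (a total order on monomials, compatible with multiplication, with $1$ smallest), and $\mathrm{in}(J)$ is the initial ideal of $J$ with respect to the fixed term order. For a monomial ideal $J$ and a variable $x$, $d_x(J)$ is the maximum exponent of $x$ in the minimal monomial generators of $J$ (and $0$ if $J=0$). An element $f\in\mathfrak m$ is regular on $R/J$ if it is a non-zerodivisor on $R/J$. A sequence of nonconstant polynomials $\alpha_1,\dots,\alpha_u\in\mathfrak m$ is an initially regular sequence on $R/I$ ($I$ a proper ideal) if for each $i=1,\dots,u$, $\alpha_i$ is regular on $R/I_i$, where $I_1=\mathrm{in}(I)$ and $I_i=\mathrm{in}\big((I_{i-1},\alpha_{i-1})\big)$ for $i\ge 2$. *)

(* Defs.v *)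
From Stdlib Require ClassicalEpsilon.
From mathcomp Require Import all_boot all_order all_algebra.
From mathcomp Require Import mpoly.

Set Implicit Arguments.
Unset Strict Implicit.
Unset Printing Implicit Defensive.

Import GRing.Theory.
Local Open Scope ring_scope.

(* Ideals are Prop-valued predicates on {mpoly K[n]}; membership is all that is
   used, so that two ideals with the same elements are interchangeable. *)

Section Ideals.
Variables (K : fieldType) (n : nat).
Implicit Types (I J S : {mpoly K[n]} -> Prop) (p f : {mpoly K[n]}).

Definition ideal_gen S p : Prop :=
  exists2 s : seq ({mpoly K[n]} * {mpoly K[n]}),
    (forall u, u \in s -> S u.2) & p = \sum_(u <- s) u.1 * u.2.

Definition add_gen J f : {mpoly K[n]} -> Prop :=
  ideal_gen (fun p => J p \/ p = f).

Definition irrelevant_ideal : {mpoly K[n]} -> Prop :=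
  ideal_gen (fun p => exists i : 'I_n, p = 'X_i).

Definition is_proper_ideal I : Prop := ~ I 1.

Definition monomial_ideal I : Prop :=
  exists S : 'X_{1..n} -> Prop,
    forall p, I p <-> ideal_gen (fun g => exists2 m, S m & g = 'X_[m]) p.

(* On monomials, (m1 <= m2)%MM is divisibility of m2 by m1. *)
Definition min_mon_gen J (m : 'X_{1..n}) : Prop :=
  J 'X_[m] /\ forall m' : 'X_{1..n}, J 'X_[m'] -> (m' <= m)%MM -> m' = m.

Definition divisible_by_var (m : 'X_{1..n}) (x : 'I_n) : bool :=
  (U_(x) <= m)%MM.

(* The specification determines d, and by Dickson's lemma such a d exists for
   every monomial ideal J, so the choice below is the intended number. *)
Definition is_max_exponent J (x : 'I_n) (d : nat) : Prop :=
  ((forall p, J p -> p = 0) /\ d = 0%N) \/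
  ((exists2 m, min_mon_gen J m & m x = d) /\
   (forall m, min_mon_gen J m -> (m x <= d)%N)).

Definition max_exponent J (x : 'I_n) : nat :=
  ClassicalEpsilon.epsilon (inhabits 0%N) (is_max_exponent J x).

(* [le m1 m2] reads "m1 is smaller than or equal to m2". *)
Definition term_order (le : rel 'X_{1..n}) : Prop :=
  [/\ total le, antisymmetric le, transitive le,
      (forall m m1 m2, le m1 m2 -> le (m1 + m)%MM (m2 + m)%MM)
    & (forall m, le 0%MM m)].

Definition var_gt (le : rel 'X_{1..n}) (x y : 'I_n) : Prop :=
  le U_(y)%MM U_(x)%MM /\ x <> y.

(* No such monomial exists for p = 0. *)
Definition is_initial_mon (le : rel 'X_{1..n}) p (m : 'X_{1..n}) : Prop :=
  m \in msupp p /\ forall m', m' \in msupp p -> le m' m.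

Definition initial_ideal (le : rel 'X_{1..n}) J : {mpoly K[n]} -> Prop :=
  ideal_gen (fun g => exists p m,
    [/\ J p, is_initial_mon le p m & g = 'X_[m]]).

Definition regular_mod J f : Prop := forall p, J (f * p) -> J p.

(* For i < size alpha, the ideal attached to the 0-based entry i of alpha is
   initial_chain le I (take i alpha). *)
Definition initial_chain (le : rel 'X_{1..n}) I (alpha : seq {mpoly K[n]}) :
    {mpoly K[n]} -> Prop :=
  foldl (fun J f => initial_ideal le (add_gen J f)) (initial_ideal le I) alpha.

Definition initially_regular (le : rel 'X_{1..n}) I
    (alpha : seq {mpoly K[n]}) : Prop :=
  (forall f, f \in alpha -> irrelevant_ideal f /\ ~ (exists c : K, f = c%:MP)) /\
  (forall i, (i < size alpha)%N ->
     regular_mod (initial_chain le I (take i alpha)) (nth 0 alpha i)).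

End Ideals.

(* For 1 <= i <= q only. *)
Definition f_form (K : fieldType) (n : nat) (b : nat -> 'I_n) (q t i : nat) :
    {mpoly K[n]} :=
  if (i < q)%N then 'X_(b i.-1) + 'X_(b i)
  else \sum_(q.-1 <= j < t.+1) 'X_(b j).

Definition g_form (K : fieldType) (n : nat) (c : nat -> nat -> 'I_n)
    (s : nat -> nat) (i : nat) : {mpoly K[n]} :=
  \sum_(0 <= j < (s i).+1) 'X_(c i j).

(* A merged sequence is recorded by its labels: inl i stands for f_i and inr i
   for g_i.  Only the f's are required to keep their relative order. *)
Definition merging (q l : nat) (w : seq (nat + nat)) : Prop :=
  (exists F G : seq nat,
     [/\ subseq F (iota 1 q), subseq G (iota 1 l)
       & perm_eq w (map inl F ++ map inr G)]) /\
  (forall i j : nat, inl i \in w -> inl j \in w -> (i < j)%N ->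
     (index (inl i) w < index (inl j) w)%N).

Definition form_of_label (K : fieldType) (n : nat) (b : nat -> 'I_n)
    (q t : nat) (c : nat -> nat -> 'I_n) (s : nat -> nat) (u : nat + nat) :
    {mpoly K[n]} :=
  match u with
  | inl i => f_form K b q t i
  | inr i => g_form K c s i
  end.

(* Main.v *)
(* Every ideal of the chain is a monomial ideal, recorded by its up-closed set S
   of exponents.  A form x + (sum of T) is regular modulo S as soon as the
   exponents of the variables of T are at most 1 in the generators and every
   generator divisible by x is divisible by a variable of T: first compare the
   parts of top degree in each y of T, then the parts free of T.

   If e1, e2 avoid the variables of f, a condition "x^(e1+v) in J implies
   x^(e2+v) in J, for all v in the variables of f" passes from J to in(J, f),
   because (J, f) is graded by the monomials in the other variables.  The
   conditions above have this shape, so they survive reduction by forms in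
   disjoint variables.  The only consecutive forms sharing a variable are
   b_(i-1) + b_i and the next f, and there the relevant graded components of J
   are zero or everything. *)

Require Import Defs.
From Stdlib Require Import Classical ClassicalEpsilon.
From mathcomp Require Import all_boot all_order all_algebra.
From mathcomp Require Import mpoly zify.

Set Implicit Arguments.
Unset Strict Implicit.
Unset Printing Implicit Defensive.

Import GRing.Theory.
Local Open Scope ring_scope.

Section Monomials.
Variable n : nat.
Implicit Types (S : 'X_{1..n} -> Prop) (m g e : 'X_{1..n}) (x y : 'I_n).

Lemma dickson_coord k S :
  exists2 L : seq 'X_{1..n}, forall g, g \in L -> S g
    & forall m, S m -> exists2 g, g \in L &
        forall i : 'I_n, (i < k)%N -> (g i <= m i)%N.
Proof.
elim: k S => [|k IHk] S.
  have [[m Sm]|noS] := classic (exists m, S m).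
    exists [:: m] => [g|m' _]; first by rewrite inE => /eqP->.
    by exists m; rewrite ?inE.
  by exists [::] => // m Sm; case: noS; exists m.
have [ltkn|lenk] := ltnP k n; last first.
  have [L LS Ldom] := IHk S; exists L => // m /Ldom[g Lg leg].
  by exists g => // i _; apply: leg; apply: leq_trans lenk.
pose x := Ordinal ltkn; have [L LS Ldom] := IHk S.
have slices N : exists2 L' : seq 'X_{1..n}, forall g, g \in L' -> S g
    & forall m, S m -> (m x < N)%N -> exists2 g, g \in L' &
        forall i : 'I_n, (i < k.+1)%N -> (g i <= m i)%N.
  elim: N => [|N [L1 L1S L1dom]]; first by exists [::].
  have [L2 L2S L2dom] := IHk (fun m => S m /\ m x = N).
  exists (L1 ++ L2) => [g|m Sm].
    by rewrite mem_cat => /orP[/L1S|/L2S[]].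
  rewrite ltnS leq_eqVlt => /orP[/eqP mxN|ltmN]; last first.
    by have [g Lg leg] := L1dom m Sm ltmN; exists g; rewrite // mem_cat Lg.
  have [g L2g leg] := L2dom m (conj Sm mxN).
  exists g => [|i]; first by rewrite mem_cat L2g orbT.
  rewrite ltnS leq_eqVlt => /orP[/eqP ik|]; last exact: leg.
  have -> : i = x by apply: val_inj.
  by rewrite mxN; have [_ ->] := L2S g L2g.
have [L' L'S L'dom] := slices (\max_(g <- L) g x)%N.
exists (L ++ L') => [g|m Sm]; first by rewrite mem_cat => /orP[/LS|/L'S].
have [ltm|lem] := ltnP (m x) (\max_(g <- L) g x)%N.
  by have [g Lg leg] := L'dom m Sm ltm; exists g; rewrite // mem_cat Lg orbT.
have [g Lg leg] := Ldom m Sm; exists g => [|i]; first by rewrite mem_cat Lg.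
rewrite ltnS leq_eqVlt => /orP[/eqP ik|]; last exact: leg.
have -> : i = x by apply: val_inj.
by apply: leq_trans lem; apply: (@leq_bigmax_seq _ _ xpredT (fun g => g x)).
Qed.

Lemma dickson S :
  exists2 L : seq 'X_{1..n}, forall g, g \in L -> S g
    & forall m, S m -> exists2 g, g \in L & (g <= m)%MM.
Proof.
have [L LS Ldom] := dickson_coord n S; exists L => // m /Ldom[g Lg leg].
by exists g => //; apply/mnm_lepP => i; apply: leg.
Qed.

Definition up_closed S := forall m e, S m -> S (m + e)%MM.

Lemma up_closed_le S m e : up_closed S -> (m <= e)%MM -> S m -> S e.
Proof. by move=> upS le_me Sm; rewrite -(submK le_me) addmC; apply: upS. Qed.

(* For a monomial ideal these two say, without mentioning generators, that d_y is
   at most 1 and that a minimal generator divisible by x is divisible by a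
   variable of T; in this form they pass to initial ideals. *)
Definition reduced_at S y :=
  forall m, S (m + U_(y) + U_(y))%MM -> S (m + U_(y))%MM.

Definition covered_by S x (T : seq 'I_n) :=
  forall m, (forall y, y \in T -> m y = 0%N) -> S (m + U_(x))%MM -> S m.

End Monomials.

Section Ideals.
Variables (K : fieldType) (n : nat).
Implicit Types (J : {mpoly K[n]} -> Prop) (p a f u : {mpoly K[n]}).
Implicit Types (S : 'X_{1..n} -> Prop) (m g e : 'X_{1..n}) (x y : 'I_n).

Definition supported S p := forall m, m \in msupp p -> S m.

Lemma supported0 S : supported S 0.
Proof. by move=> m; rewrite msupp0. Qed.

Lemma supportedD S p u : supported S p -> supported S u -> supported S (p + u).
Proof.
by move=> Sp Su m /msuppD_le; rewrite mem_cat => /orP[/Sp|/Su].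
Qed.

Lemma supportedM S a p : up_closed S -> supported S p -> supported S (a * p).
Proof.
move=> upS Sp m /msuppM_le /allpairsP[[m1 m2] /= [_ m2p ->]].
by rewrite addmC; apply/upS/Sp.
Qed.

Lemma supportedX S m : supported S ('X_[m] : {mpoly K[n]}) <-> S m.
Proof.
split=> [|Sm e]; first by apply; rewrite msuppX inE.
by rewrite msuppX inE => /eqP->.
Qed.

Lemma ideal_gen_ext (G H : {mpoly K[n]} -> Prop) p :
  (forall u, G u -> H u) -> ideal_gen G p -> ideal_gen H p.
Proof. by move=> GH [s sG ->]; exists s => // u /sG/GH. Qed.

Lemma ideal_genD (G : {mpoly K[n]} -> Prop) p u :
  ideal_gen G p -> ideal_gen G u -> ideal_gen G (p + u).
Proof.
move=> [s sG ->] [s' s'G ->]; exists (s ++ s'); last by rewrite big_cat.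
by move=> v; rewrite mem_cat => /orP[/sG|/s'G].
Qed.

Lemma ideal_gen0 (G : {mpoly K[n]} -> Prop) : ideal_gen G 0.
Proof. by exists [::]; rewrite ?big_nil. Qed.

Lemma ideal_gen_mul (G : {mpoly K[n]} -> Prop) a u : G u -> ideal_gen G (a * u).
Proof.
move=> Gu; exists [:: (a, u)]; last by rewrite big_seq1.
by move=> v; rewrite inE => /eqP->.
Qed.

Lemma ideal_gen_monomialsE (G : 'X_{1..n} -> Prop) p :
  ideal_gen (fun u => exists2 m, G m & u = 'X_[m]) p <->
  supported (fun m => exists2 g, G g & (g <= m)%MM) p.
Proof.
split=> [[s sG ->]|Gp].
  rewrite big_seq; elim/big_ind: _ => [||v /sG[g Gg ->]].
  - exact: supported0.
  - exact: supportedD.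
  apply: supportedM; last by apply/supportedX; exists g; rewrite ?lepm_refl.
  by move=> m e [h Gh leh]; exists h => //; apply: lepm_trans leh (lem_addr _ _).
rewrite [p]mpolyE big_seq; elim/big_ind: _ => [||m /Gp[g Gg legm]].
- exact: ideal_gen0.
- exact: ideal_genD.
have -> : p@_m *: 'X_[m] = (p@_m *: 'X_[(m - g)]) * 'X_[g] :> {mpoly K[n]}.
  by rewrite -scalerAl -mpolyXD submK.
by apply: ideal_gen_mul; exists g.
Qed.

Definition represents S J := up_closed S /\ forall p, J p <-> supported S p.

Lemma monomial_ideal_represented J :
  monomial_ideal J -> exists S, represents S J.
Proof.
move=> [G JG]; exists (fun m => exists2 g, G g & (g <= m)%MM); split.
  by move=> m e [g Gg leg]; exists g => //; apply: lepm_trans leg (lem_addr _ _).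
by move=> p; rewrite JG ideal_gen_monomialsE.
Qed.

Lemma represents_monomial S J m : represents S J -> J 'X_[m] <-> S m.
Proof. by move=> [_ ->]; apply: supportedX. Qed.

Lemma min_mon_gen_below S J m : represents S J -> S m ->
  exists2 g, min_mon_gen J g & (g <= m)%MM.
Proof.
move=> SJ; have [k] := ubnP (mdeg m); elim: k m => // k IHk m ltk Sm.
have [mmin|notmin] := classic (min_mon_gen J m).
  by exists m; rewrite ?lepm_refl.
have [h [Sh leh neqh]] : exists h, [/\ S h, (h <= m)%MM & h <> m].
  apply: NNPP => noh; apply: notmin; split; first exact/(represents_monomial m SJ).
  move=> h /(represents_monomial h SJ) Sh leh; apply: NNPP => neqh.
  by apply: noh; exists h.
have [|g gmin leg] := IHk h _ Sh; last by exists g => //; apply: lepm_trans leh.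
suff : (mdeg h < mdeg m)%N by lia.
rewrite -(submK leh) mdegD -[X in (X < _)%N]add0n ltn_add2r lt0n mdeg_eq0.
by apply/eqP => d0; apply: neqh; rewrite -(submK leh) d0 add0m.
Qed.

Lemma max_exponent_spec S J x : represents S J ->
  is_max_exponent J x (max_exponent J x).
Proof.
move=> SJ; apply: epsilon_spec.
have [L Lmin Ldom] := dickson (min_mon_gen J).
have memL m : min_mon_gen J m -> m \in L.
  move=> mmin; have [g Lg leg] := Ldom m mmin.
  by have [Jg _] := Lmin g Lg; case: mmin => _ /(_ g Jg leg) <-.
case: L => [|g0 L] in Lmin Ldom memL *.
  exists 0%N; left; split=> // p Jp; apply/eqP; rewrite -msupp_eq0.
  case supp: (msupp p) => [//|m r].
  have Sm : S m by apply: (proj1 (proj2 SJ p) Jp); rewrite supp inE eqxx.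
  by have [g /memL] := min_mon_gen_below SJ Sm.
exists (\max_(g <- g0 :: L) g x)%N; right; split; last first.
  by move=> m /memL mL; apply: (@leq_bigmax_seq _ _ xpredT (fun g => g x)).
have [i _ ->] : exists2 i : 'I_(size L).+1, true &
    (\max_(g <- g0 :: L) g x = nth g0 (g0 :: L) i x)%N.
  rewrite (big_nth g0) big_mkord.
  have [|i _] := @eq_bigmax_cond 'I_(size L).+1 xpredT
    (fun i => nth g0 (g0 :: L) i x).
    by rewrite card_ord.
  by move->; exists i.
by exists (nth g0 (g0 :: L) i) => //; apply/Lmin/mem_nth.
Qed.

Lemma max_exponent_reduced S J x : represents S J ->
  (max_exponent J x <= 1)%N -> reduced_at S x.
Proof.
move=> SJ le1 m Sm; have [g gmin leg] := min_mon_gen_below SJ Sm.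
have gx : (g x <= 1)%N.
  case: (max_exponent_spec x SJ) => [[J0 _]|[_ /(_ g gmin) gx]]; last by lia.
  have /J0/(congr1 (fun p => p@_g)) := proj1 gmin.
  by rewrite mcoeffX eqxx mcoeff0 => /eqP; rewrite oner_eq0.
apply: (up_closed_le (proj1 SJ) _ (proj1 (represents_monomial g SJ) (proj1 gmin))).
apply/mnm_lepP => i; move/mnm_lepP/(_ i): leg.
rewrite !mnmDE !mnm1E; case: (x =P i) => [<-|_]; lia.
Qed.

Lemma min_mon_gen_covered S J x T : represents S J ->
    (forall m, min_mon_gen J m -> divisible_by_var m x ->
       exists2 y, y \in T & divisible_by_var m y) ->
    x \notin T -> covered_by S x T.
Proof.
move=> SJ cov xT m mT Sm; have [g gmin leg] := min_mon_gen_below SJ Sm.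
apply: (up_closed_le (proj1 SJ) _ (proj1 (represents_monomial g SJ) (proj1 gmin))).
have gx : g x = 0%N.
  apply/eqP/negP => /negP gx; have [|y Ty gy] := cov g gmin.
    by rewrite /divisible_by_var lep1mP.
  move: gy; rewrite /divisible_by_var lep1mP; move/mnm_lepP/(_ y): leg.
  rewrite mnmDE mnm1E (mT y Ty); case: (x =P y) => [xy|_]; last by lia.
  by rewrite xy Ty in xT.
apply/mnm_lepP => i; move/mnm_lepP/(_ i): leg.
rewrite !mnmDE !mnm1E; case: (x =P i) => [<-|_]; lia.
Qed.

Definition linear_form (s : seq 'I_n) : {mpoly K[n]} := \sum_(x <- s) 'X_x.

Lemma mcoeff_mulX a x e :
  (a * 'X_x)@_e = if (0 < e x)%N then a@_(e - U_(x)) else 0.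
Proof.
case: ifP => [ex|/negbT ex].
  have le : (U_(x) <= e)%MM by rewrite lep1mP; lia.
  by rewrite -{1}(submK le) addmC mcoeffMX.
apply: memN_msupp_eq0; apply/negP; rewrite (perm_mem (msuppMX _ _)).
by case/mapP=> m _ em; rewrite em mnmDE mnm1E eqxx in ex.
Qed.

Lemma mcoeff_mul_linear_form a s e :
  (a * linear_form s)@_e =
  \sum_(x <- s) if (0 < e x)%N then a@_(e - U_(x)) else 0.
Proof.
rewrite /linear_form mulr_sumr (raddf_sum (mcoeff e)).
by apply: eq_bigr => x _; apply: mcoeff_mulX.
Qed.

Lemma linear_form_irrelevant s : irrelevant_ideal (linear_form s).
Proof.
rewrite /linear_form; elim/big_ind: _ => [||x _].
- exact: ideal_gen0.
- exact: ideal_genD.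
by rewrite -['X_x]mul1r; apply: ideal_gen_mul; exists x.
Qed.

Lemma linear_form_nonconstant x s : uniq (x :: s) ->
  ~ exists c : K, linear_form (x :: s) = c%:MP.
Proof.
move=> /andP[xs _] [c /(congr1 (mcoeff U_(x)))]; rewrite mcoeffC mnm1_eq0 mulr0.
rewrite -[linear_form _]mul1r mcoeff_mul_linear_form big_cons big_seq big1.
  have subUU : (U_(x) - U_(x))%MM = 0%MM :> 'X_{1..n}.
    by apply/mnmP => i; rewrite mnmBE subnn mnm0E.
  by rewrite addr0 mnm1E eqxx subUU mcoeff1 eqxx => /eqP; rewrite oner_eq0.
by move=> y ys; rewrite mnm1E; case: eqP => // xy; rewrite xy ys in xs.
Qed.

Definition form_condition S x (T : seq 'I_n) :=
  (forall y, y \in T -> reduced_at S y) /\ covered_by S x T.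

Lemma linear_form_regular S J x T : represents S J -> uniq (x :: T) ->
  form_condition S x T -> regular_mod J (linear_form (x :: T)).
Proof.
move=> [upS JE] uT [red cov] p; rewrite !JE mulrC => Sfp.
have coeff0 e : ~ S e -> (p * linear_form (x :: T))@_e = 0.
  by move=> nSe; apply: memN_msupp_eq0; apply/negP => /Sfp.
have noT y m : y \in T -> m \in msupp p -> ~ S m -> m y = 0%N.
  move=> Ty mp nSm; apply/eqP; rewrite eqn0Ngt; apply/negP => my.
  have [k] := ubnP (msize p - m y); elim: k m mp nSm my => // k IHk m mp nSm my ltk.
  have lemy : (m y <= mdeg m)%N by rewrite mdegE (bigD1 y) //= leq_addr.
  have ltm := msize_mdeg_lt mp.
  have nSe : ~ S (m + U_(y))%MM.
    have le : (U_(y) <= m)%MM by rewrite lep1mP -lt0n.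
    by rewrite -(submK le) => /(red y Ty); rewrite submK.
  have := coeff0 _ nSe; rewrite mcoeff_mul_linear_form.
  rewrite (bigD1_seq y) ?inE ?Ty ?orbT //= big1 => [|z zy].
    rewrite addr0 mnmDE mnm1E eqxx addn1 /= addmK => /eqP.
    by rewrite mcoeff_eq0 mp.
  rewrite mnmDE mnm1E eq_sym (negPf zy) addn0; case: ifP => // mz.
  apply: memN_msupp_eq0; apply/negP => hp; apply: (IHk _ hp).
  - move=> /(up_closed_le upS) Sh; apply/nSe/Sh/lem_subr.
  - by rewrite mnmBE mnmDE !mnm1E eqxx (negPf zy); lia.
  - rewrite mnmBE mnmDE !mnm1E eqxx (negPf zy); lia.
move=> m mp; apply: NNPP => nSm.
have nSe : ~ S (m + U_(x))%MM by move=> /cov Sm; apply/nSm/Sm => y Ty; apply: noT.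
have := coeff0 _ nSe; rewrite mcoeff_mul_linear_form big_cons big_seq big1.
  by rewrite addr0 mnmDE mnm1E eqxx addn1 /= addmK => /eqP; rewrite mcoeff_eq0 mp.
move=> y Ty; rewrite mnmDE mnm1E (noT y m Ty mp nSm).
by case: eqP => // xy; case/andP: uT => xT; rewrite xy Ty in xT.
Qed.

End Ideals.

Section InitialIdeals.
Variables (K : fieldType) (n : nat) (le : rel 'X_{1..n}).
Hypothesis le_order : term_order le.
Implicit Types (J : {mpoly K[n]} -> Prop) (p a f u : {mpoly K[n]}).
Implicit Types (S : 'X_{1..n} -> Prop) (m e v : 'X_{1..n}) (x y : 'I_n).
Implicit Types (s T : seq 'I_n).

Let le_total : total le. Proof. by case: le_order. Qed.
Let le_anti : antisymmetric le. Proof. by case: le_order. Qed.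
Let le_trans : transitive le. Proof. by case: le_order. Qed.
Let le_add m m1 m2 : le m1 m2 -> le (m1 + m)%MM (m2 + m)%MM.
Proof. by case: le_order => _ _ _ + _; apply. Qed.

Lemma le_add_cancel m m1 m2 : le (m1 + m)%MM (m2 + m)%MM -> le m1 m2.
Proof.
case/orP: (le_total m1 m2) => // le21 le12.
suff -> : m1 = m2 by case/orP: (le_total m2 m2).
apply: (can_inj (addmK m)); apply: le_anti; rewrite le12 /=; exact: le_add.
Qed.

Lemma initial_mon_exists p : p != 0 -> exists m, is_initial_mon le p m.
Proof.
rewrite -msupp_eq0 /is_initial_mon; elim: (msupp p) => // m0 [|m1 r] IHr _.
  exists m0; split=> [|m]; rewrite inE // => /eqP->.
  by case/orP: (le_total m0 m0).
have [//|m [rm max_m]] := IHr.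
have [le0|le0] := orP (le_total m0 m).
  exists m; split=> [|h]; first by rewrite inE rm orbT.
  by rewrite inE => /predU1P[->|/max_m].
exists m0; split=> [|h]; first by rewrite inE eqxx.
rewrite inE => /predU1P[->|/max_m]; first by case/orP: (le_total m0 m0).
by move=> leh; apply: le_trans le0.
Qed.

Lemma initial_mon_mulX p m e :
  is_initial_mon le p m -> is_initial_mon le (p * 'X_[e]) (m + e)%MM.
Proof.
move=> [pm max_m]; split=> [|h]; rewrite (perm_mem (msuppMX _ _)).
  by rewrite addmC; apply: map_f.
by case/mapP=> h' /max_m leh ->; rewrite addmC; apply: le_add.
Qed.

Lemma initial_idealE J p : initial_ideal le J p <->
  supported (fun m => exists2 g,
    (exists2 u, J u & is_initial_mon le u g) & (g <= m)%MM) p.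
Proof.
rewrite -ideal_gen_monomialsE; split; apply: ideal_gen_ext => u.
  by move=> [v [m [Jv vm ->]]]; exists m => //; exists v.
by move=> [m [v Jv vm] ->]; exists v, m.
Qed.

Lemma initial_ideal_monomial S J : represents S J ->
  represents S (initial_ideal le J).
Proof.
move=> SJ; have [upS JE] := SJ; split=> // p; rewrite initial_idealE.
split=> Sp m /Sp => [[g [u /JE Su [/Su Sg _]] legm]|Sm].
  exact: up_closed_le legm Sg.
exists m; rewrite ?lepm_refl //; exists 'X_[m]; first exact/(represents_monomial m SJ).
split=> [|h]; rewrite msuppX inE // => /eqP->; by case/orP: (le_total m m).
Qed.

Definition initial_step S f m :=
  exists p a, is_initial_mon le p m /\ supported S (p - a * f).

Lemma initial_step_up_closed S f : up_closed S -> up_closed (initial_step S f).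
Proof.
move=> upS m e [p [a [pm Sp]]]; exists (p * 'X_[e]), (a * 'X_[e]).
split; first exact: initial_mon_mulX.
by rewrite mulrAC -mulrBl mulrC; apply: supportedM.
Qed.

Lemma sub_initial_step S f m : S m -> initial_step S f m.
Proof.
move=> Sm; exists 'X_[m], 0; rewrite mul0r subr0; split; last exact/supportedX.
split=> [|h]; rewrite msuppX inE // => /eqP->; by case/orP: (le_total m m).
Qed.

Lemma add_gen_represented S J f p : represents S J ->
  add_gen J f p <-> exists a, supported S (p - a * f).
Proof.
move=> [upS JE]; split=> [[s sJ ->]|[a Sp]].
  rewrite big_seq; elim/big_ind: _ => [|p1 p2 [a1 S1] [a2 S2]|[c u] /sJ /= [/JE Su|->]].
  - by exists 0; rewrite mul0r subr0; apply: supported0.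
  - by exists (a1 + a2); rewrite mulrDl opprD addrACA; apply: supportedD.
  - by exists 0; rewrite mul0r subr0; apply: supportedM.
  by exists c; rewrite subrr; apply: supported0.
rewrite -[p](subrK (a * f)); apply: ideal_genD.
  by rewrite -[X in ideal_gen _ X]mul1r; apply: ideal_gen_mul; left; apply/JE.
by apply: ideal_gen_mul; right.
Qed.

Lemma initial_step_represents S J f : represents S J ->
  represents (initial_step S f) (initial_ideal le (add_gen J f)).
Proof.
move=> SJ; have up := initial_step_up_closed (f := f) (proj1 SJ).
split=> // p; rewrite initial_idealE; split=> Sp m /Sp.
  move=> [g [u /(add_gen_represented _ _ SJ)[a Su] ug] leg].
  by apply: up_closed_le leg _ => //; exists u, a.
move=> [u [a [um Su]]]; exists m; rewrite ?lepm_refl //; exists u => //.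
by apply/(add_gen_represented _ _ SJ); exists a.
Qed.

Definition mon_on s e : 'X_{1..n} :=
  [multinom if i \in s then e i else 0%N | i < n].
Definition mon_off s e : 'X_{1..n} :=
  [multinom if i \in s then 0%N else e i | i < n].

Lemma mon_split s e : (mon_off s e + mon_on s e)%MM = e.
Proof. by apply/mnmP => i; rewrite mnmDE !mnmE; case: ifP => _; lia. Qed.

Lemma mon_onE s e x : mon_on s e x = if x \in s then e x else 0%N.
Proof. exact: mnmE. Qed.

Lemma mon_offE s e x : mon_off s e x = if x \in s then 0%N else e x.
Proof. exact: mnmE. Qed.

Lemma mon_off_add s e v : (forall x, x \in s -> e x = 0%N) ->
  mon_off s (e + mon_on s v) = e.
Proof.
move=> es; apply/mnmP => i; rewrite mon_offE mnmDE mon_onE.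
by case si: (i \in s); [rewrite es | rewrite addn0].
Qed.

Lemma mon_on_add s e v : (forall x, x \in s -> e x = 0%N) ->
  mon_on s (e + mon_on s v) = mon_on s v.
Proof.
move=> es; apply/mnmP => i; rewrite !mon_onE mnmDE mon_onE.
by case si: (i \in s); rewrite // es.
Qed.

(* Multiplication by the outer part [e2] composed with division by [e1], applied
   to the component of [p] whose monomials have outer part [e1]; it commutes
   with multiplication by polynomials in the variables [s]. *)
Definition transport s e1 e2 p : {mpoly K[n]} :=
  \sum_(m <- msupp p | mon_off s m == e1) p@_m *: 'X_[(e2 + mon_on s m)].

Lemma mcoeff_transport s e1 e2 p e :
    (forall x, x \in s -> e1 x = 0%N) -> (forall x, x \in s -> e2 x = 0%N) ->
  (transport s e1 e2 p)@_e =
  if mon_off s e == e2 then p@_(e1 + mon_on s e) else 0.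
Proof.
move=> e1s e2s; rewrite /transport (raddf_sum (mcoeff e)) /=.
case: eqP => [off_e|off_e]; last first.
  apply: big1 => m _; rewrite mcoeffZ mcoeffX; case: eqP => [me|_]; last by rewrite mulr0.
  by case: off_e; rewrite -me mon_off_add.
rewrite [in RHS](mpolyE p) (raddf_sum (mcoeff _)) /= big_mkcond /=.
apply: eq_bigr => m _; rewrite !mcoeffZ !mcoeffX.
have -> : (m == e1 + mon_on s e)%MM =
    (mon_off s m == e1) && ((e2 + mon_on s m)%MM == e).
  apply/eqP/andP => [->|[/eqP <- /eqP <-]].
    by rewrite mon_off_add // mon_on_add // -off_e mon_split !eqxx.
  by rewrite mon_on_add // mon_split.
by case: eqP => _ //=; rewrite mulr0.
Qed.

Lemma mcoeff_transport_mul s e1 e2 a e :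
    (forall x, x \in s -> e1 x = 0%N) -> (forall x, x \in s -> e2 x = 0%N) ->
  (transport s e1 e2 a * linear_form K s)@_e =
  if mon_off s e == e2 then (a * linear_form K s)@_(e1 + mon_on s e) else 0.
Proof.
move=> e1s e2s; rewrite !mcoeff_mul_linear_form.
have offB x : x \in s -> mon_off s (e - U_(x))%MM = mon_off s e.
  move=> sx; apply/mnmP => i; rewrite !mon_offE mnmBE mnm1E.
  by case: ifP => // si; case: eqP => [xi|_]; [rewrite -xi sx in si|rewrite subn0].
case: eqP => off_e; last first.
  rewrite big_seq big1 // => x sx; case: ifP => // _.
  by rewrite mcoeff_transport // offB //; case: eqP.
rewrite big_seq [RHS]big_seq; apply: eq_bigr => x sx.
rewrite mnmDE e1s // mon_onE sx add0n; case: ifP => // ex.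
rewrite mcoeff_transport // offB // off_e eqxx; congr (_@_ _).
apply/mnmP => i; rewrite mnmDE mnmBE mnmDE mnm1E !mon_onE mnmBE mnm1E.
case: eqP => [<-|_]; last by rewrite !subn0.
by rewrite sx e1s.
Qed.

Lemma initial_step_component S s e1 e2 v :
    (forall x, x \in s -> e1 x = 0%N) -> (forall x, x \in s -> e2 x = 0%N) ->
    initial_step S (linear_form K s) (e1 + mon_on s v)%MM ->
  initial_step (fun e => mon_off s e = e2 /\ S (e1 + mon_on s e)%MM)
    (linear_form K s) (e2 + mon_on s v)%MM.
Proof.
move=> e1s e2s [p [a [[pv max_v] Sp]]].
exists (transport s e1 e2 p), (transport s e1 e2 a); split; first split.
- by rewrite mcoeff_msupp mcoeff_transport // mon_off_add // eqxx mon_on_add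
    // -mcoeff_msupp.
- move=> e; rewrite mcoeff_msupp mcoeff_transport //.
  case: (mon_off s e =P e2) => [off_e|_]; last by rewrite eqxx.
  rewrite -mcoeff_msupp => /max_v; rewrite ![(e1 + _)%MM]addmC => /le_add_cancel.
  by move=> /(le_add e2); rewrite ![(_ + e2)%MM]addmC -{1}off_e mon_split.
move=> e; rewrite mcoeff_msupp mcoeffB mcoeff_transport // mcoeff_transport_mul //.
case: (mon_off s e =P e2) => [off_e|_]; last by rewrite subrr eqxx.
by rewrite -mcoeffB -mcoeff_msupp => /Sp.
Qed.

Lemma initial_step_transfer S s m (d1 d2 : 'X_{1..n}) :
    (forall x, x \in s -> d1 x = 0%N) -> (forall x, x \in s -> d2 x = 0%N) ->
    (forall v, S (mon_off s m + mon_on s v + d1)%MM ->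
       S (mon_off s m + mon_on s v + d2)%MM) ->
  initial_step S (linear_form K s) (m + d1)%MM ->
  initial_step S (linear_form K s) (m + d2)%MM.
Proof.
move=> d1s d2s S12.
have swap d : (m + d)%MM = ((mon_off s m + d) + mon_on s m)%MM.
  by rewrite -{1}(mon_split s m) -!addmA [(d + _)%MM]addmC.
have zero (d : 'X_{1..n}) : (forall x, x \in s -> d x = 0%N) ->
    forall x, x \in s -> (mon_off s m + d)%MM x = 0%N.
  by move=> ds x sx; rewrite mnmDE mon_offE sx ds.
rewrite !swap => /(initial_step_component (zero _ d1s) (zero _ d2s)).
move=> [p [a [pm Sp]]]; exists p, a; split=> // e /Sp[off_e].
rewrite -[in X in _ -> X](mon_split s e) off_e.
by rewrite -!addmA ![(_ + mon_on s e)%MM]addmC !addmA; apply: S12.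
Qed.

Lemma reduced_at_step S s y : y \notin s -> reduced_at S y ->
  reduced_at (initial_step S (linear_form K s)) y.
Proof.
move=> sy red m; rewrite -addmA.
have U0 x : x \in s -> U_(y)%MM x = 0%N :> nat.
  by move=> sx; rewrite mnm1E; case: eqP => // yx; rewrite yx sx in sy.
apply: initial_step_transfer => // [x sx|v]; first by rewrite mnmDE U0.
by rewrite addmA; apply: red.
Qed.

Lemma covered_by_step S s x T :
    x \notin s -> (forall y, y \in T -> y \notin s) -> covered_by S x T ->
  covered_by (initial_step S (linear_form K s)) x T.
Proof.
move=> sx Ts cov m mT; rewrite -[X in _ -> initial_step _ _ X]addm0.
apply: initial_step_transfer => [z sz|z|v]; rewrite ?mnm0E // ?addm0.
  by rewrite mnm1E; case: eqP => // xz; rewrite xz sz in sx.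
apply: cov => y Ty; rewrite mnmDE mon_offE mon_onE (negPf (Ts y Ty)) addn0.
exact: mT.
Qed.

Lemma form_condition_step S s x T : (forall y, y \in x :: T -> y \notin s) ->
  form_condition S x T ->
  form_condition (initial_step S (linear_form K s)) x T.
Proof.
move=> xTs [red cov]; split=> [y Ty|].
  by apply: reduced_at_step; [apply: xTs; rewrite inE Ty orbT | apply: red].
by apply: covered_by_step => // [|y Ty]; apply: xTs; rewrite inE ?eqxx ?Ty ?orbT.
Qed.

Lemma covered_by_muln S x T m k : covered_by S x T -> x \notin T ->
  (forall y, y \in T -> m y = 0%N) -> S (m + U_(x) *+ k)%MM -> S m.
Proof.
move=> cov xT mT; elim: k => [|k IHk]; first by rewrite mulm0n addm0.
rewrite mulmSr addmA => /cov Sm; apply/IHk/Sm => y Ty.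
rewrite mnmDE mT // mulmnE mnm1E; case: eqP => // xy.
by rewrite xy Ty in xT.
Qed.

Lemma initial_mon_mul_binomial x y a m : var_gt le x y ->
  is_initial_mon le (a * linear_form K [:: x; y]) m ->
  exists e, m = (e + U_(x))%MM.
Proof.
move=> [le_yx neq_xy] [am max_m]; exists (m - U_(x))%MM.
rewrite submK // lep1mP; apply/eqP => mx.
have coeff e : (a * linear_form K [:: x; y])@_e =
    (if (0 < e x)%N then a@_(e - U_(x)) else 0) +
    (if (0 < e y)%N then a@_(e - U_(y)) else 0).
  by rewrite mcoeff_mul_linear_form big_cons big_seq1.
have neqU e : (e + U_(y) = e + U_(x))%MM -> False.
  move=> /addmI/mnmP/(_ x); rewrite !mnm1E eqxx.
  by case: eqP => // yx; case: neq_xy.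
have lt_add e e' : le e' (e + U_(y))%MM -> le (e + U_(x))%MM e' -> False.
  have le_e : le (e + U_(y))%MM (e + U_(x))%MM by rewrite ![(e + _)%MM]addmC le_add.
  move=> le1 le2; apply: (neqU e); apply: le_anti.
  by rewrite le_e (le_trans le2 le1).
move: (am); rewrite mcoeff_msupp coeff mx add0r.
case: ifP => [my aym|_]; last by rewrite eqxx.
have a0 : a != 0 by apply: contraNneq aym => ->; rewrite mcoeff0.
have [e [ae max_e]] := initial_mon_exists a0.
apply: (lt_add e m).
  have le_ym : (U_(y) <= m)%MM by rewrite lep1mP -lt0n.
  by rewrite -{1}(submK le_ym); apply/le_add/max_e; rewrite mcoeff_msupp.
apply: max_m; rewrite mcoeff_msupp coeff mnmDE mnm1E eqxx addn1 /= addmK.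
case: ifP => [ey|_]; last by rewrite addr0 -mcoeff_msupp.
rewrite [X in _ + X]memN_msupp_eq0 ?addr0 -?mcoeff_msupp //.
have le_y : (U_(y) <= e + U_(x))%MM by rewrite lep1mP -lt0n.
apply/negP => /max_e /(le_add U_(y)); rewrite submK // => le1.
by apply: lt_add le1 _; case/orP: (le_total (e + U_(x))%MM (e + U_(x))%MM).
Qed.

(* If [m] avoids [T] then by the hypotheses the ideal of monomials in [x], [y]
   multiplying the outer part of [m] into [S] is zero or the unit ideal, so its
   sum with [x + y] has initial ideal [(x)] or [(1)]. *)
Lemma covered_by_binomial_step S x y T :
    up_closed S -> var_gt le x y -> x \notin T -> y \notin T ->
    covered_by S x [:: y] -> covered_by S y T ->
  covered_by (initial_step S (linear_form K [:: x; y])) y T.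
Proof.
move=> upS gt_xy xT yT covx covy m mT; pose s := [:: x; y].
have neq_xy : x != y by apply/eqP; case: gt_xy.
pose o := mon_off s m; have os z : z \in s -> o z = 0%N.
  by move=> sz; rewrite mon_offE sz.
have -> : (m + U_(y) = o + mon_on s (m + U_(y)))%MM.
  apply/mnmP => i; rewrite !mnmDE mon_offE mon_onE mnmDE mnm1E.
  by case: ifP => // si; case: eqP => [yi|_]; [rewrite -yi !inE eqxx orbT in si|].
move=> /(initial_step_component os os)[p [a [pm Sp]]].
have oT z : z \in T -> o z = 0%N by move=> Tz; rewrite mon_offE mT ?if_same.
have [So|nSo] := classic (S o).
  by apply: sub_initial_step; rewrite -(mon_split s m); apply: upS.
have p_af : p = a * linear_form K s.
  apply/eqP; rewrite -subr_eq0 -msupp_eq0; case supp: (msupp _) => [//|h r].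
  have [_ Sh] : mon_off s h = o /\ S (o + mon_on s h)%MM.
    by apply: Sp; rewrite supp inE eqxx.
  case: nSo; apply: (covered_by_muln (x := x) (k := h x) covx) => [|z|].
  - by rewrite inE.
  - by rewrite inE => /eqP->; apply: os; rewrite !inE eqxx orbT.
  apply: (covered_by_muln (x := y) (k := h y) covy) => // [z Tz|].
    rewrite mnmDE oT // mulmnE mnm1E; case: eqP => // xz.
    by rewrite xz Tz in xT.
  apply: up_closed_le Sh => //; apply/mnm_lepP => i.
  rewrite !mnmDE !mulmnE !mnm1E mon_onE !inE [x == i]eq_sym [y == i]eq_sym.
  case: (i =P x) => [->|_]; first by rewrite (negPf neq_xy) /=; lia.
  by case: (i =P y) => [->|_] /=; rewrite !mul0n ?mul1n ?addn0.
have [e] : exists e, (o + mon_on s (m + U_(y)) = e + U_(x))%MM.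
  by apply: (initial_mon_mul_binomial gt_xy (a := a)); rewrite -p_af.
move=> /mnmP/(_ x); rewrite !mnmDE os ?mon_onE ?inE ?eqxx // mnmDE !mnm1E eqxx.
rewrite [y == x]eq_sym (negPf neq_xy) addn0 add0n => mx.
apply: (@up_closed_le _ _ U_(x)%MM); first exact: initial_step_up_closed.
  by rewrite lep1mP; lia.
exists (linear_form K s), 1; split; last by rewrite mul1r subrr; apply: supported0.
have fE e' : e' \in msupp (linear_form K s) -> e' = U_(x)%MM \/ e' = U_(y)%MM.
  rewrite /linear_form big_cons big_seq1 => /msuppD_le.
  by rewrite mem_cat !msuppX !inE => /orP[]/eqP->; [left|right].
split=> [|e' /fE[]->]; last by case: gt_xy.
  rewrite mcoeff_msupp /linear_form big_cons big_seq1 mcoeffD !mcoeffXU eqxx.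
  by rewrite [y == x]eq_sym (negPf neq_xy) addr0 oner_eq0.
by case/orP: (le_total U_(x)%MM U_(x)%MM).
Qed.

(* [Inv w S] is what is known of the current monomial ideal [S] while the labels
   [w] are still ahead. *)
Lemma initial_chain_regular (A : Type) (hd : A -> 'I_n) (tl : A -> seq 'I_n)
    (Inv : seq A -> ('X_{1..n} -> Prop) -> Prop) :
    (forall k w S, up_closed S -> Inv (k :: w) S ->
       [/\ uniq (hd k :: tl k), form_condition S (hd k) (tl k)
         & Inv w (initial_step S (linear_form K (hd k :: tl k)))]) ->
  forall (w : seq A) S J i, represents S J -> Inv w S -> (i < size w)%N ->
  let alpha := [seq linear_form K (hd k :: tl k) | k <- w] in
  regular_mod (foldl (fun J f => initial_ideal le (add_gen J f)) J (take i alpha))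
    (nth 0 alpha i).
Proof.
move=> step; elim=> [//|u w IHw] S J i SJ inv.
have [uniq_u cond_u inv_w] := step u w S (proj1 SJ) inv.
case: i => [_|i ltiw] /=; first exact: (linear_form_regular SJ).
by apply: IHw inv_w _; first exact: initial_step_represents.
Qed.

End InitialIdeals.

Unset Implicit Arguments.

Theorem theorem4p14 (K : fieldType) (n : nat) (I : {mpoly K[n]} -> Prop)
    (I_monomial : monomial_ideal I) (I_proper : is_proper_ideal I)
    (* the variables b_0, ..., b_t; values of b beyond t are not used *)
    (t q : nat) (b : nat -> 'I_n)
    (q_bounds : (1 <= q <= t)%N)
    (b_distinct : forall i j : nat,
       (i <= t)%N -> (j <= t)%N -> b i = b j -> i = j)
    (b_exponent : forall i : nat, (1 <= i <= t)%N ->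
       (max_exponent I (b i) <= 1)%N)
    (b_chain : forall (i : nat) (m : 'X_{1..n}), (1 <= i <= q.-1)%N ->
       min_mon_gen I m -> divisible_by_var m (b i.-1) ->
       divisible_by_var m (b i))
    (b_last : forall m : 'X_{1..n},
       min_mon_gen I m -> divisible_by_var m (b q.-1) ->
       exists2 j : nat, (q <= j <= t)%N & divisible_by_var m (b j))
    (* the set {y_1, ..., y_r} *)
    (Y : {set 'I_n})
    (Y_disjoint : forall i : nat, (i <= t)%N -> b i \notin Y)
    (* the variables c_{i,j}, for 1 <= i <= l and 0 <= j <= s_i *)
    (l : nat) (s : nat -> nat) (c : nat -> nat -> 'I_n)
    (c_in_Y : forall i j : nat, (1 <= i <= l)%N -> (j <= s i)%N -> c i j \in Y)
    (c_distinct : forall i j i' j' : nat,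
       (1 <= i <= l)%N -> (j <= s i)%N -> (1 <= i' <= l)%N -> (j' <= s i')%N ->
       c i j = c i' j' -> i = i' /\ j = j')
    (c_exponent : forall i j : nat, (1 <= i <= l)%N -> (1 <= j <= s i)%N ->
       (max_exponent I (c i j) <= 1)%N)
    (c_cover : forall (i : nat) (m : 'X_{1..n}), (1 <= i <= l)%N ->
       min_mon_gen I m -> divisible_by_var m (c i 0%N) ->
       exists2 j : nat, (1 <= j <= s i)%N & divisible_by_var m (c i j))
    (le : rel 'X_{1..n}) (le_term_order : term_order le)
    (b_order : forall i : nat, (1 <= i <= t)%N -> var_gt le (b i.-1) (b i))
    (c_order : forall i j : nat, (1 <= i <= l)%N -> (1 <= j <= s i)%N ->
       var_gt le (c i 0%N) (c i j))
    (w : seq (nat + nat)) (w_merging : merging q l w) :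
  initially_regular le I (map (form_of_label K b q t c s) w).
Proof.
  (* your proof *)
Proof.
have I_ideal := monomial_ideal_represented I_monomial.
pose valid (u : nat + nat) : bool :=
  match u with inl i => 1 <= i <= q | inr i => 1 <= i <= l end%N.
pose hd (u : nat + nat) : 'I_n :=
  match u with inl i => b i.-1 | inr i => c i 0%N end.
pose tl (u : nat + nat) : seq 'I_n :=
  match u with
  | inl i => if (i < q)%N then [:: b i] else [seq b j | j <- index_iota q t.+1]
  | inr i => [seq c i j | j <- index_iota 1 (s i).+1]
  end.
have tlP u y : valid u -> y \in tl u -> match u with
    | inl i => exists2 j, (i <= j <= t)%N & y = b j
    | inr i => exists2 j, (1 <= j <= s i)%N & y = c i j
    end.
  case: u => i /= ui.
    case: ifP => iq; first by rewrite inE => /eqP->; exists i => //; lia.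
    by case/mapP=> j; rewrite mem_index_iota => jt ->; exists j => //; lia.
  by case/mapP=> j; rewrite mem_index_iota => js ->; exists j => //; lia.
have varsP u y : valid u -> y \in hd u :: tl u -> match u with
    | inl i => exists2 j, (i.-1 <= j <= t)%N & y = b j
    | inr i => exists2 j, (j <= s i)%N & y = c i j
    end.
  move=> uv; rewrite inE => /predU1P[->|/(tlP u y uv)].
    case: u uv => i /= ui; first by exists i.-1 => //; lia.
    by exists 0%N.
  case: u uv => i /= ui [j ji ->]; exists j => //; lia.
have hd_tl u : valid u -> hd u \notin tl u.
  move=> uv; apply/negP => /(tlP u _ uv); case: u uv => i /= ui [j ji].
    by move/b_distinct => E; have := E _ _; lia.
  by move/c_distinct => E; have [] := E ui _ ui _; lia.
have vars_uniq u : valid u -> uniq (hd u :: tl u).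
  move=> uv; rewrite cons_uniq hd_tl //=; case: u uv => i /= ui.
    case: ifP => // iq; rewrite map_inj_in_uniq ?iota_uniq // => j k.
    by rewrite !mem_index_iota => jt kt /b_distinct; apply; lia.
  rewrite map_inj_in_uniq ?iota_uniq // => j k.
  rewrite !mem_index_iota => js ks /c_distinct E.
  by have [] := E ui _ ui _; lia.
have formE u : valid u -> form_of_label K b q t c s u = linear_form K (hd u :: tl u).
  rewrite /linear_form big_cons; case: u => i /= ui.
    rewrite /f_form; case: ifP => iq; first by rewrite big_seq1.
    have -> : i = q by lia.
    by rewrite big_ltn ?big_map ?prednK //; lia.
  by rewrite /g_form big_ltn // big_map.
have [S SI] := I_ideal.
have cond0 u : valid u -> form_condition S (hd u) (tl u).
  move=> uv; split=> [y /(tlP u y uv)|].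
    case: u uv => i /= ui [j ji ->]; apply: (max_exponent_reduced SI).
      by apply: b_exponent; lia.
    exact: c_exponent.
  apply: (min_mon_gen_covered SI) (hd_tl u uv) => m m_min.
  case: u uv => i /= ui m_hd.
    case: ifP => iq.
      by exists (b i); rewrite ?inE //; apply: b_chain m_hd => //; lia.
    have iq' : i = q by lia.
    rewrite iq' in m_hd; have [j jt mj] := b_last m m_min m_hd.
    by exists (b j) => //; apply: map_f; rewrite mem_index_iota; lia.
  have [j js mj] := c_cover i m ui m_min m_hd.
  by exists (c i j) => //; apply: map_f; rewrite mem_index_iota; lia.
have [[F [G [subF subG w_perm]]] w_order] := w_merging.
have w_uniq : uniq w.
  rewrite (perm_uniq w_perm) cat_uniq !map_inj_uniq; last 2 first.
  - by move=> i j [].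
  - by move=> i j [].
  rewrite (subseq_uniq subF) ?(subseq_uniq subG) ?iota_uniq // andbT /=.
  by apply/hasPn => u /mapP[i _ ->]; apply/negP => /mapP[].
have w_valid u : u \in w -> valid u.
  rewrite (perm_mem w_perm) mem_cat => /orP[]/mapP[i].
    by move=> /(mem_subseq subF); rewrite mem_iota => iq -> /=; lia.
  by move=> /(mem_subseq subG); rewrite mem_iota => iq -> /=; lia.
pose precedes (u v : nat + nat) : bool :=
  match u, v with
  | inl i, inl j => (i < j)%N
  | inr i, inr j => i != j
  | _, _ => true
  end.
have w_precedes : pairwise precedes w.
  apply/(pairwiseP (inl 0%N)) => i j iw jw ltij.
  have index_i := index_uniq (inl 0%N) iw w_uniq.
  have index_j := index_uniq (inl 0%N) jw w_uniq.
  have wi := mem_nth (inl 0%N) iw; have wj := mem_nth (inl 0%N) jw.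
  move: index_i index_j wi wj.
  case: (nth _ w i) (nth _ w j) => [k|k] [k'|k'] //= index_i index_j wi wj.
    case: (ltngtP k k') => // [lt|eqk]; last by rewrite eqk in index_i; lia.
    by have := w_order _ _ wj wi lt; rewrite index_i index_j; lia.
  by apply/eqP => eqk; rewrite eqk in index_i; lia.
pose later (u v : nat + nat) : bool :=
  match u, v with
  | inl i, inl j => (i <= j)%N
  | inr i, inr j => i == j
  | _, _ => false
  end.
have later_refl u : later u u by case: u => i /=.
split=> [f /mapP[u /w_valid uv ->]|i].
  rewrite formE //; split; first exact: linear_form_irrelevant.
  by apply: linear_form_nonconstant; apply: vars_uniq.
rewrite size_map.
have -> : [seq form_of_label K b q t c s u | u <- w] =
    [seq linear_form K (hd u :: tl u) | u <- w].
  by apply/eq_in_map => u /w_valid; apply: formE.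
pose Inv (w' : seq (nat + nat)) (S' : 'X_{1..n} -> Prop) :=
  [/\ pairwise precedes w', forall u, u \in w' -> valid u
    & forall u v, u \in w' -> valid v -> later u v ->
        form_condition S' (hd v) (tl v)].
apply: (@initial_chain_regular K n le le_term_order _ hd tl Inv _ w S);
  last 2 first.
- exact: initial_ideal_monomial SI.
- by split=> // u v _ /cond0.
move=> {i} u w' S' upS' [/= /andP[u_w' w'_pw] w'_valid w'_cond].
have uv := w'_valid u (mem_head _ _); split.
- exact: vars_uniq.
- exact: w'_cond (mem_head _ _) uv (later_refl u).
split=> // [v v_w'|v z v_w' zv later_vz]; first by apply: w'_valid; rewrite inE v_w' orbT.
have cond_z : form_condition S' (hd z) (tl z).
  by apply: w'_cond later_vz => //; rewrite inE v_w' orbT.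
have cond_u := w'_cond _ _ (mem_head _ _) uv (later_refl u).
have prec := allP u_w' v v_w'.
have disjoint_step : (forall y, y \in hd z :: tl z -> y \in hd u :: tl u -> False) ->
    form_condition (initial_step le S' (linear_form K (hd u :: tl u))) (hd z) (tl z).
  move=> dis; apply: form_condition_step => // y zy; apply/negP; exact: dis.
have {prec later_vz} prec : precedes u z.
  case: u v z {w'_valid w'_cond uv zv u_w' cond_u cond_z disjoint_step v_w'}
    prec later_vz => i [j|j] [k|k] //=; last by move=> ? /eqP<-.
  exact: leq_trans.
case: u z uv zv prec cond_u cond_z disjoint_step {u_w' w'_valid w'_cond}
  => i [k|k] uv zv prec cond_u cond_z disjoint_step.
- have [ik|] := ltnP i.+1 k.
    apply: disjoint_step => y /(varsP _ _ zv)[x xk ->].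
    have iq : (i < q)%N by move: zv => /=; lia.
    rewrite /= iq !inE => /orP[]/eqP/b_distinct E; have := E _ _; lia.
  move=> {disjoint_step} ki; have {ki prec} kE : k = i.+1 by move: prec => /=; lia.
  rewrite {k}kE in zv cond_z *.
  have iq : (i < q)%N by move: zv => /=; lia.
  have i_pos : (0 < i)%N by move: uv => /=; lia.
  have tl_u : tl (inl i) = [:: b i] by rewrite /= iq.
  have notin_tl x : (x <= i)%N -> b x \notin tl (inl i.+1).
    move=> xi; apply/negP => /(tlP _ _ zv)[x' xi' /b_distinct E].
    by have := E _ _; lia.
  move: cond_u cond_z; rewrite tl_u => -[_ cov_u] [red_z cov_z]; split=> [y Ty|].
    apply: reduced_at_step; [by [] | | exact: red_z].
    rewrite !inE; apply/norP.
    by split; apply: contraTneq Ty => ->; apply: notin_tl; lia.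
  apply: covered_by_binomial_step => //; [apply: b_order | apply: notin_tl | apply: notin_tl];
    by lia.
- apply: disjoint_step => y /(varsP _ _ zv)[x xk ->] /(varsP _ _ uv)[x' xi] E.
  have /negP[] := Y_disjoint x' (proj2 (andP xi)).
  by rewrite -E c_in_Y.
- apply: disjoint_step => y /(varsP _ _ zv)[x xk ->] /(varsP _ _ uv)[x' xi] E.
  have /negP[] := Y_disjoint x (proj2 (andP xk)).
  by rewrite E c_in_Y.
apply: disjoint_step => y /(varsP _ _ zv)[x xk ->] /(varsP _ _ uv)[x' xi].
by move/c_distinct=> /= E; have [] := E zv xk uv xi => ki; rewrite ki /= eqxx in prec.
Qed.
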